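(* Let $G$ be a threshold graph. Then $$\chi_1(G)=\begin{cases}\frac{\chi(G)}{3}+1, & \text{if } \chi(G)\equiv 0 \pmod 3 \text{ and } G \text{ is not } \omega\text{-unique},\\[2pt] \left\lceil \frac{\chi(G)}{3}\right\rceil, & \text{otherwise.}\end{cases}$$ Moreover, every split graph $G$ satisfies $\chi_1(G)\le \left\lceil \frac{\chi(G)-1}{3}\right\rceil+1$, and this bound is tight except for bipartite $G$: for every integer $t\ge 3$ there is a split graph $G$ with $\chi(G)=t$ and $\chi_1(G)=\left\lceil \frac{t-1}{3}\right\rceil+1$. In particular, if $G$ is a split graph with $\chi(G)\equiv 1 \pmod 3$, then $\chi_1(G)=\frac{\chi(G)+2}{3}$.
   Context: All graphs are finite and simple. A 1-selection of a graph $G=(V,E)$ is a map $f$ assigning to each vertex $v$ a set $f(v)$ of at most one edge incident with $v$. The 1-removed subgraph $G_f$ has vertex set $V$ and edge set $E\setminus\bigcup_{v\in V}f(v)$. The robust chromatic number is $\chi_1(G)=\min_f \chi(G_f)$, the minimum over all 1-selections $f$ of $G$. A graph is a split graph if its vertex set can be partitioned into a clique and an independent set. A graph $G$ is a threshold graph if there exist a real $h$ and a function $g:V(G)\to\mathbb{R}$ such that distinct $x,y$ are adjacent iff $g(x)+g(y)>h$. A graph $G$ is $\omega$-unique if it contains exactly one clique of order $\omega(G)$ (the clique number). *)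

(* Defs.v *)
From HB Require Import structures.
From mathcomp Require Import all_boot all_order all_algebra.
From mathcomp Require Import reals.

Set Implicit Arguments.
Unset Strict Implicit.
Unset Printing Implicit Defensive.

Import Order.TTheory GRing.Theory Num.Theory.

Record sgraph := SGraph {
  vertex :> finType;
  adj : rel vertex;
  adj_sym : symmetric adj;
  adj_irrefl : irreflexive adj }.

Section Graph.
Variable G : sgraph.
Implicit Types (x y v : G) (S K : {set G}) (e : {set G}).

Definition edges : {set {set G}} :=
  [set e | [exists x, exists y, adj x y && (e == [set x; y])]].

Definition clique S : bool :=
  [forall x in S, forall y in S, (x != y) ==> adj x y].

Definition independent S : bool :=
  [forall x in S, forall y in S, ~~ adj x y].

Definition clique_number : nat := \max_(S : {set G} | clique S) #|S|.

Definition omega_unique : bool :=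
  #|[set S : {set G} | clique S & #|S| == clique_number]| == 1.

Definition split_graph : bool :=
  [exists K : {set G}, clique K && independent (~: K)].

Definition threshold_graph (R : realType) : Prop :=
  exists (h : R) (g : G -> R),
    forall x y, x != y -> adj x y = (h < g x + g y)%R.

Definition colorable (k : nat) : bool :=
  [exists c : {ffun G -> 'I_k}, forall x, forall y, adj x y ==> (c x != c y)].

Fact colorable_ex : exists k, colorable k.
Proof.
exists #|G|; apply/existsP; exists [ffun x => enum_rank x].
apply/forallP=> x; apply/forallP=> y; apply/implyP=> xy; rewrite !ffunE.
by apply: contraTneq xy => /enum_rank_inj->; rewrite adj_irrefl.
Qed.

Definition chromatic_number : nat := ex_minn colorable_ex.

Definition one_selection (f : {ffun G -> {set {set G}}}) : bool :=
  [forall v, (#|f v| <= 1) &&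
             (f v \subset [set e in edges | v \in e])].

Section Removed.
Variable f : {ffun G -> {set {set G}}}.

Definition removed_adj : rel G :=
  fun x y => adj x y && ([set x; y] \notin \bigcup_v f v).

Fact removed_adj_sym : symmetric removed_adj.
Proof. by move=> x y; rewrite /removed_adj adj_sym setUC. Qed.

Fact removed_adj_irrefl : irreflexive removed_adj.
Proof. by move=> x; rewrite /removed_adj adj_irrefl. Qed.

Definition removed_subgraph : sgraph :=
  SGraph removed_adj_sym removed_adj_irrefl.

End Removed.

End Graph.

Lemma edges_removed_subgraph (G : sgraph) (f : {ffun G -> {set {set G}}}) :
  edges (removed_subgraph f) = edges G :\: \bigcup_v f v.
Proof.
apply/setP=> e; rewrite !inE; apply/existsP/andP.
  case=> x /existsP[y /andP[/andP[xy nf] /eqP->]]; split=> //.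
  by apply/existsP; exists x; apply/existsP; exists y; rewrite xy eqxx.
case=> nf /existsP[x /existsP[y /andP[xy /eqP De]]].
exists x; apply/existsP; exists y.
by rewrite De eqxx andbT /= /removed_adj xy -De.
Qed.

Fact robust_ex (G : sgraph) :
  exists k, [exists f : {ffun G -> {set {set G}}},
    one_selection f && (chromatic_number (removed_subgraph f) == k)].
Proof.
pose f : {ffun G -> {set {set G}}} := [ffun _ => set0].
exists (chromatic_number (removed_subgraph f)).
apply/existsP; exists f; rewrite eqxx andbT.
by apply/forallP=> v; rewrite ffunE cards0 sub0set.
Qed.

Definition robust_chromatic_number (G : sgraph) : nat := ex_minn (robust_ex G).

Notation chi := chromatic_number.
Notation chi1 := robust_chromatic_number.

(* Main.v *)
Require Import Defs.
From HB Require Import structures.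
From mathcomp Require Import all_boot all_order all_algebra.
From mathcomp Require Import reals.
From mathcomp Require Import zify lra.

Set Implicit Arguments.
Unset Strict Implicit.
Unset Printing Implicit Defensive.

Import Order.TTheory GRing.Theory Num.Theory.

(* A class of a colouring of G_f spans at most as many edges as it has vertices,
   each vertex selecting at most one of them; in particular it meets a clique in
   at most three vertices, which gives chi_1 >= omega / 3. Conversely a split
   graph with a maximum clique K is coloured by cutting most of K into triangles
   and joining the independent part to a remainder A of at most three vertices of
   K, provided that each independent vertex has at most one neighbour in A. One
   vertex always works as A; in a threshold graph the two vertices of K of least
   weight have this property, and so do the three of least weight if K is the only
   maximum clique. If it is not, two maximum cliques K and K - a + b exist, and
   with omega / 3 colours each class would meet both in exactly three vertices, so
   that a and b would lie in a monochromatic diamond. *)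

Lemma chi_le (G : sgraph) k :
  chi G <= k <-> exists c : G -> 'I_k, forall x y, adj x y -> c x != c y.
Proof.
rewrite /chromatic_number; case: ex_minnP => n /existsP[c cP] n_min.
split=> [nk|[d dP]].
  exists (fun x => widen_ord nk (c x)) => x y xy.
  by move/forallP/(_ x)/forallP/(_ y)/implyP/(_ xy): cP.
apply: n_min; apply/existsP; exists (finfun d).
by apply/forallP=> x; apply/forallP=> y; rewrite !ffunE; apply/implyP/dP.
Qed.

(** * Robust colourings and cliques *)

Section RobustColoring.
Variable G : sgraph.
Implicit Types (S K A : {set G}) (x y v a b : G).

Lemma adj_neq x y : adj x y -> x != y.
Proof. by apply: contraTneq => ->; rewrite adj_irrefl. Qed.

Lemma cliqueP S :
  reflect {in S &, forall x y, x != y -> adj x y} (clique S).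
Proof.
apply: (iffP forall_inP) => [H x y xS yS|H x xS].
  by move/(_ x xS)/forall_inP/(_ y yS)/implyP: H.
by apply/forall_inP=> y yS; apply/implyP; apply: H.
Qed.

Lemma independentP S :
  reflect {in S &, forall x y, ~~ adj x y} (independent S).
Proof.
apply: (iffP forall_inP) => [H x y xS yS|H x xS].
  by move/(_ x xS)/forall_inP/(_ y yS): H.
by apply/forall_inP=> y yS; apply: H.
Qed.

(** Encodes a 1-selection together with a proper colouring of what it leaves. A value [p x] not
    adjacent to [x] stands for an empty selection at [x]. *)
Definition robust_coloring k (c : G -> 'I_k) (p : G -> G) :=
  forall x y, adj x y -> c x = c y -> p x = y \/ p y = x.

(* [p x] is the other endpoint of the edge selected at [x]. *)
Lemma chi1_le (k : nat) :
  chi1 G <= k <-> exists (c : G -> 'I_k) p, robust_coloring c p.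
Proof.
rewrite /robust_chromatic_number; case: ex_minnP => n.
case/existsP=> f /andP[/forallP f_sel /eqP chi_f] n_min; split=> [nk|[c [p cp]]].
  have /chi_le[c cP] : chi (removed_subgraph f) <= k by rewrite chi_f.
  exists c, (fun x => odflt x [pick y | [set x; y] \in f x]).
  suff sel x y : adj x y -> [set x; y] \in f x ->
      odflt x [pick y | [set x; y] \in f x] = y.
    move=> x y xy cxy; have : ~~ @adj (removed_subgraph f) x y.
      by apply/negP=> /cP; rewrite cxy eqxx.
    rewrite /= /removed_adj xy /= negbK => /bigcupP[v _ xyv].
    have /andP[_ /subsetP/(_ _ xyv)] := f_sel v.
    rewrite !inE => /andP[_ /orP[]/eqP vE]; rewrite vE in xyv.
      by left; apply: sel.
    by right; apply: sel; rewrite 1?adj_sym // setUC.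
  move=> xy xyf; case: pickP => [z xzf|/(_ y)]; last by rewrite xyf.
  have /andP[/card_le1_eqP/(_ _ _ xzf xyf) xzxy _] := f_sel x.
  have : y \in [set x; z] by rewrite -xzxy !inE eqxx orbT.
  by rewrite !inE eq_sym (negPf (adj_neq xy)) => /eqP.
pose f' : {ffun G -> {set {set G}}} :=
  [ffun x => if adj x (p x) then [set [set x; p x]] else set0].
apply: (@leq_trans (chi (removed_subgraph f'))).
  apply: n_min; apply/existsP; exists f'; rewrite eqxx andbT.
  apply/forallP=> v; rewrite ffunE; case: ifP => [vp|_]; last first.
    by rewrite cards0 sub0set.
  rewrite cards1 sub1set !inE eqxx /= andbT.
  by apply/existsP; exists v; apply/existsP; exists (p v); rewrite vp eqxx.
apply/chi_le; exists c => x y /= /andP[xy]; apply: contraNneq => cxy.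
apply/bigcupP; case: (cp _ _ xy cxy) => [pE|pE].
  by exists x; rewrite // ffunE pE xy set11.
by exists y; rewrite // ffunE pE adj_sym xy setUC set11.
Qed.

Lemma chi1_le_chi : chi1 G <= chi G.
Proof.
have /chi_le[c cP] := leqnn (chi G).
by apply/chi1_le; exists c, id => x y /cP/eqP.
Qed.

Section Fibers.
Variables (k : nat) (c : G -> 'I_k) (p : G -> G).
Hypothesis cp : robust_coloring c p.

(* A diamond has five edges on four vertices, each of which selects only one. *)
Lemma no_monochromatic_diamond a b u w : a != b ->
  adj a u -> adj a w -> adj b u -> adj b w -> adj u w ->
  c a = c u -> c b = c u -> c w = c u -> False.
Proof.
move=> /eqP ab au aw bu bw uw ca cb cw.
have /eqP ? := adj_neq au; have /eqP ? := adj_neq aw.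
have /eqP ? := adj_neq bu; have /eqP ? := adj_neq bw.
have /eqP ? := adj_neq uw.
have := cp au ca; have := cp bu cb.
have := cp aw (etrans ca (esym cw)); have := cp bw (etrans cb (esym cw)).
have := cp uw (esym cw).
by do 5![case=> ?]; congruence.
Qed.

Definition fiber S i := [set x in S | c x == i].

Lemma card_fiber_clique S i : clique S -> #|fiber S i| <= 3.
Proof.
move/cliqueP=> cS; rewrite leqNgt; apply/negP=> gt3.
have /card_gt0P[a aF] : 0 < #|fiber S i| by apply: leq_trans gt3.
have : 2 < #|fiber S i :\ a| by move: gt3; rewrite (cardsD1 a) aF.
case/card_gt2P=> b [u [w [[bF uF wF] [bu uw wb]]]].
move: aF bF uF wF; rewrite !inE => /andP[aS /eqP ca].
move=> /and3P[ba bS /eqP cb] /and3P[ua uS /eqP cu] /and3P[wa wS /eqP cw].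
apply: (@no_monochromatic_diamond a b u w); rewrite ?cu //;
  by [rewrite eq_sym | apply: cS; rewrite // eq_sym].
Qed.

Lemma card_sum_fibers S : #|S| = \sum_i #|fiber S i|.
Proof.
rewrite -sum1_card (partition_big c predT) //=; apply: eq_bigr => i _.
by rewrite -sum1_card; apply: eq_bigl => x; rewrite inE.
Qed.

(** By [card_fiber_clique] the truncated subtractions are exact, so the sum measures how far the
    classes fall short of three vertices of [S]. *)
Lemma clique_deficiency S :
  clique S -> #|S| + \sum_i (3 - #|fiber S i|) = 3 * k.
Proof.
move=> cS; rewrite card_sum_fibers -big_split /=.
rewrite (eq_bigr (fun=> 3)) => [|i _]; last by rewrite subnKC ?card_fiber_clique.
by rewrite sum_nat_const card_ord mulnC.
Qed.

(** One class falls short by at most the total deficiency; if [#|S| = 3 * k], every class holds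
    three vertices of [S]. *)
Lemma clique_fiber_bound S i : clique S -> #|S| + 3 <= 3 * k + #|fiber S i|.
Proof.
move/clique_deficiency <-; rewrite (bigD1 i) //=; lia.
Qed.

End Fibers.

Lemma clique_le_chi1 S : clique S -> #|S| <= 3 * chi1 G.
Proof.
have /chi1_le[c [p cp]] := leqnn (chi1 G).
by move/(clique_deficiency cp) <-; apply: leq_addr.
Qed.

Lemma exchangeable_clique_lt_chi1 K a b : a \in K -> b \notin K ->
  clique K -> clique (b |: K :\ a) -> #|K| < 3 * chi1 G.
Proof.
move=> aK bK cK cK'.
have ab : a != b by apply: contraNneq bK => <-.
have cardK' : #|b |: K :\ a| = #|K|.
  by rewrite cardsU1 !inE (negPf bK) andbF (cardsD1 a K) aK.
rewrite ltnNge; apply/negP=> geK.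
have /chi1_le[c [p cp]] := leqnn (chi1 G).
have := clique_fiber_bound cp (c a) cK; have := clique_fiber_bound cp (c a) cK'.
rewrite cardK' => gtK' gtK.
(* If [b] has another colour, the class of [a] loses [a] and gains nothing, yet it needs three
   vertices in both cliques. *)
have [cb|cb] := eqVneq (c b) (c a); last first.
  suff : #|fiber c (b |: K :\ a) (c a)| < #|fiber c K (c a)|.
    have := card_fiber_clique cp (c a) cK; lia.
  apply: proper_card; apply/properP; split.
    apply/subsetP=> x; rewrite !inE => /andP[/orP[/eqP->|/andP[_ ->] //]].
    by rewrite (negPf cb).
  by exists a; rewrite !inE ?aK eqxx ?(negPf ab).
have : 1 < #|fiber c K (c a) :\ a|.
  by have := cardsD1 a (fiber c K (c a)); rewrite inE aK eqxx /=; lia.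
case/card_gt1P=> u [w [uF wF uw]].
move: uF wF; rewrite !inE => /and3P[ua uK /eqP cu] /and3P[wa wK /eqP cw].
have [/cliqueP cKP /cliqueP cK'P] := (cK, cK').
have ub : b != u by apply: contraNneq bK => ->.
have wb : b != w by apply: contraNneq bK => ->.
apply: (@no_monochromatic_diamond _ c p cp a b u w); rewrite ?cu //.
- by apply: cKP; rewrite // eq_sym.
- by apply: cKP; rewrite // eq_sym.
- by apply: cK'P; rewrite ?inE ?eqxx ?ua ?uK ?orbT.
- by apply: cK'P; rewrite ?inE ?eqxx ?wa ?wK ?orbT.
- exact: cKP.
Qed.

(* Rotates each block of three consecutive entries of [s]. *)
Definition rotate3 (s : seq G) x :=
  let i := index x s in nth x s (3 * (i %/ 3) + (i %% 3).+1 %% 3).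

(** Any two of three cyclically ordered entries are consecutive in one direction, so one edge per
    vertex covers a triangle. *)
Lemma rotate3P (s : seq G) x y : x \in s -> y \in s -> x != y ->
  index x s %/ 3 = index y s %/ 3 -> rotate3 s x = y \/ rotate3 s y = x.
Proof.
move=> xs ys xy; rewrite /rotate3.
have ij : index x s != index y s by apply: contraNneq xy => /index_inj->.
have [<- <-] := (nth_index x xs, nth_index y ys); rewrite !nth_index //.
set i := index x s in ij *; set j := index y s in ij * => eq_ij.
have : 3 * (i %/ 3) + (i %% 3).+1 %% 3 = j \/ 3 * (j %/ 3) + (j %% 3).+1 %% 3 = i.
  by move: ij eq_ij; lia.
by case=> ->; [left|right]; rewrite nth_index.
Qed.

(** Colour 0 goes to [A] and to the independent part, the other colours to blocks of three of
    [K :\: A]. Blocks and [A] select by rotation, independent vertices select their edge to [a]. The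
    [+ 2] rounds the number of blocks up. *)
Lemma chi1_split_le K A a : independent (~: K) -> A \subset K -> #|A| <= 3 ->
    (forall v x, v \notin K -> x \in A -> adj v x -> x = a) ->
  chi1 G <= ((#|K| - #|A| + 2) %/ 3).+1.
Proof.
move=> /independentP iK sAK A3 Aa; set k := _ %/ 3.
pose B := enum (K :\: A).
have BE x : (x \in B) = (x \in K) && (x \notin A) by rewrite mem_enum !inE andbC.
have sB : size B = #|K| - #|A| by rewrite -cardE cardsD (setIidPr sAK).
pose c x := if x \in B then (index x B %/ 3).+1 else 0.
have ck x : c x < k.+1.
  rewrite /c; case: ifP => // xB; move: xB; rewrite -index_mem sB /k; lia.
pose p x := if x \in B then rotate3 B x
            else if x \in A then rotate3 (enum A) x else a.
apply/chi1_le; exists (fun x => Ordinal (ck x)), p => x y xy [].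
have nxy := adj_neq xy.
rewrite /c /p; case: ifP => xB; case: ifP => yB //; first by case; exact: rotate3P.
move=> _.
have out z : z \in B = false -> z \in A = false -> z \notin K.
  by rewrite BE => + zA; rewrite zA andbT => ->.
case: ifP => xA; case: ifP => yA.
- have idx z : z \in A -> index z (enum A) %/ 3 = 0.
    by move=> zA; move: A3; have := index_mem z (enum A);
       rewrite mem_enum zA -cardE; lia.
  by apply: rotate3P; rewrite ?mem_enum ?idx.
- by right; rewrite (Aa y x) ?out // adj_sym.
- by left; rewrite (Aa x y) ?out.
- by move: xy; rewrite (negPf (iK x y _ _)) ?inE ?out.
Qed.

End RobustColoring.

(** * Split graphs *)

Section SplitGraphs.
Variable G : sgraph.
Implicit Types (S K : {set G}) (x y v a b : G).

Lemma clique_le_chi S : clique S -> #|S| <= chi G.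
Proof.
move=> /cliqueP cS; have /chi_le[c cP] := leqnn (chi G).
rewrite -(card_ord (chi G)) -(@card_in_imset _ _ c S) ?max_card // => x y xS yS.
by move=> cxy; apply/eqP; apply: contraPT cxy => /cS-/(_ xS yS)/cP/eqP.
Qed.

Lemma clique_le_number S : clique S -> #|S| <= clique_number G.
Proof. exact: (leq_bigmax_cond (F := fun S : {set G} => #|S|)). Qed.

Lemma max_clique_exists : exists2 K : {set G}, clique K & #|K| = clique_number G.
Proof.
have [|K cK maxK] := @eq_bigmax_cond _ [pred S : {set G} | clique S] (fun S => #|S|).
  by apply/card_gt0P; exists set0; apply/cliqueP=> x y; rewrite inE.
by exists K; last exact/esym.
Qed.

Lemma card_clique_independent S K :
  clique S -> independent K -> #|S :&: K| <= 1.
Proof.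
move=> /cliqueP cS /independentP iK; apply/card_le1_eqP=> x y.
rewrite !inE => /andP[xS xK] /andP[yS yK]; apply/eqP.
by apply: contraNT (iK y x yK xK); apply: cS.
Qed.

(** For [a] in [K] this is a swap; with [a := v] nothing is removed and [K] grows. *)
Lemma exchange_clique K a v : clique K -> v \notin K ->
  (forall x, x \in K -> x != a -> adj v x) -> clique (v |: K :\ a).
Proof.
move=> /cliqueP cK vK va; apply/cliqueP=> x y; rewrite !inE.
case/predU1P=> [->|/andP[xa xK]]; case/predU1P=> [->|/andP[ya yK]] xy.
- by rewrite eqxx in xy.
- exact: va.
- by rewrite adj_sym va.
- exact: cK.
Qed.

Lemma max_clique_nonneighbor K v :
  clique K -> #|K| = clique_number G -> v \notin K ->
  exists2 x, x \in K & ~~ adj v x.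
Proof.
move=> cK maxK vK; apply/exists_inP; rewrite -negb_forall_in.
apply: contra_eqN maxK => /forall_inP vK_adj.
have cvK : clique (v |: K :\ v).
  by apply: exchange_clique => // x xK _; apply: vK_adj.
have := clique_le_number cvK.
rewrite cardsU1 !inE eqxx /= (cardsD1 v K) (negPf vK) => /ltn_eqF.
by rewrite eq_sym => ->.
Qed.

Lemma split_max_clique : split_graph G ->
  exists K, [/\ clique K, independent (~: K) & #|K| = clique_number G].
Proof.
case/existsP=> K /andP[cK iK]; have [M cM maxM] := max_clique_exists.
have [leMK|ltKM] := leqP #|M| #|K|.
  by exists K; split=> //; apply/eqP; rewrite eqn_leq clique_le_number // -maxM.
exists M; split=> //.
(* [M] has at most one vertex outside [K] but is larger than [K], so it has room for all of [K]. *)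
have sKM : K \subset M.
  have := card_clique_independent cM iK; rewrite -setDE => le1.
  by apply/setIidPr/eqP; rewrite eqEcard subsetIr; have := cardsID K M; lia.
move/independentP: iK => iK; apply/independentP=> x y.
by rewrite !inE => xM yM; apply: iK; rewrite inE;
   [apply: contra xM | apply: contra yM]; apply: (subsetP sKM).
Qed.

(** The vertices of a maximum clique [K] serve as colours: a vertex outside [K] takes the colour of
    a nonneighbour in [K], which exists by maximality. *)
Lemma chi_split : split_graph G -> chi G = clique_number G.
Proof.
case/split_max_clique=> K [cK /independentP iK maxK].
apply/eqP; rewrite eqn_leq -{2}maxK clique_le_chi // andbT -maxK.
pose d x := odflt x [pick y in K | ~~ adj x y].
have dP x : x \notin K -> d x \in K /\ ~~ adj x (d x).
  move=> xK; rewrite /d; case: pickP => [y /andP[] //|none].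
  have [y yK nxy] := max_clique_nonneighbor cK maxK xK.
  by move: (none y); rewrite yK nxy.
pose c x := if x \in K then x else d x.
have cK' x : c x \in K by rewrite /c; case: ifP => // /negbT/dP[].
apply/chi_le; exists (fun x => enum_rank_in (cK' x) (c x)) => x y xy.
apply/negP=> /eqP/(congr1 enum_val); rewrite !enum_rankK_in // /c.
case: ifPn => xK; case: ifPn => yK cxy.
- by rewrite cxy adj_irrefl in xy.
- by have [_] := dP y yK; rewrite -cxy adj_sym xy.
- by have [_] := dP x xK; rewrite cxy xy.
- by have := iK x y; rewrite !inE xK yK xy => /(_ isT isT).
Qed.

Lemma chi1_split_upper : split_graph G -> chi1 G <= ((chi G + 1) %/ 3).+1.
Proof.
move=> splitG; have [K [cK iK maxK]] := split_max_clique splitG.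
rewrite chi_split // -maxK.
(* An empty [K] offers no vertex for [A], but then [chi G = 0]. *)
have [K0|[a aK]] := set_0Vmem K.
  apply: leq_trans (chi1_le_chi G) _.
  by rewrite chi_split // -maxK K0 cards0.
have sK : [set a] \subset K by rewrite sub1set.
have := chi1_split_le (a := a) iK sK; rewrite cards1 => /(_ isT) le1.
have aP v x : v \notin K -> x \in [set a] -> adj v x -> x = a.
  by rewrite inE => _ /eqP.
have := le1 aP; have : 0 < #|K| by apply/card_gt0P; exists a.
lia.
Qed.

Lemma chi_le_chi1 : split_graph G -> chi G <= 3 * chi1 G.
Proof.
move=> splitG; have [K [cK _ maxK]] := split_max_clique splitG.
by rewrite chi_split // -maxK clique_le_chi1.
Qed.

(** By maximality a vertex outside [K] misses one of the two vertices of [K], so it has at most one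
    neighbour and can select that edge; [a] selects the edge of [K]. *)
Lemma chi1_split_bipartite : split_graph G -> chi G = 2 -> chi1 G <= 1.
Proof.
move=> splitG chi2; have [K [cK iK maxK]] := split_max_clique splitG.
have K2 : #|K| = 2 by rewrite maxK -chi_split.
have /cards2P[a [b [ab KE]]] : #|K| == 2 by rewrite K2.
pose p x := if x == a then b else if [pick y in K | adj x y] is Some y then y else x.
have pP x y : x \notin K -> y \in K -> adj x y -> p x = y.
  move=> xK yK xy; rewrite /p; case: eqVneq => [xa|_].
    by rewrite xa KE !inE eqxx in xK.
  case: pickP => [z /andP[zK xz]|/(_ y)]; last by rewrite yK xy.
  have [w wK nxw] := max_clique_nonneighbor cK maxK xK.
  have nwz : w != z by apply: contraNneq nxw => ->.
  have nwy : w != y by apply: contraNneq nxw => ->.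
  move: wK yK zK nwz nwy; rewrite KE !inE.
  by case/orP=> /eqP->; case/orP=> /eqP->; case/orP=> /eqP->; rewrite ?eqxx.
apply/chi1_le; exists (fun=> ord0), p => x y xy _.
have [xK|xK] := boolP (x \in K); have [yK|yK] := boolP (y \in K).
- have := adj_neq xy; move: xK yK; rewrite KE !inE /p.
  case/orP=> /eqP->; case/orP=> /eqP->; rewrite ?eqxx // => _;
    by [left | right].
- by right; apply: pP; rewrite // adj_sym.
- by left; apply: pP.
- by move/independentP: iK => /(_ x y); rewrite !inE xK yK xy => /(_ isT isT).
Qed.

End SplitGraphs.

(** * Threshold graphs *)

Section Threshold.
Variables (R : realType) (G : sgraph).
Hypothesis thG : threshold_graph G R.

Lemma threshold_split : split_graph G.
Proof.
case: thG => h [g gP]; apply/existsP; exists [set x | (h < g x + g x)%R].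
apply/andP; split.
  by apply/cliqueP=> x y; rewrite !inE => hx hy xy; rewrite gP //; lra.
apply/independentP=> x y; rewrite !inE => hx hy; apply/negP=> xy.
by move: (xy) hx hy; rewrite (gP _ _ (adj_neq xy)); lra.
Qed.

(** Replacing a vertex of a clique by an outside one at least as heavy keeps it a clique. Comparing
    the weights of [a] and [b] decides which of [K], [K'] is modified. *)
Lemma threshold_max_exchange (K K' : {set G}) :
    clique K -> clique K' -> #|K| = clique_number G ->
    #|K'| = clique_number G -> K != K' ->
  exists (M : {set G}) (a b : G), [/\ a \in M, b \notin M, clique M, #|M| = clique_number G
    & clique (b |: M :\ a)].
Proof.
case: thG => h [g gP].
have exch (M : {set G}) a b : clique M -> a \in M -> b \notin M -> (g a <= g b)%R ->
    clique (b |: M :\ a).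
  move=> cM aM bM gab; apply: exchange_clique => // x xM xa.
  have bx : b != x by apply: contraNneq bM => ->.
  have : adj a x by move/cliqueP: cM; apply; rewrite // eq_sym.
  by rewrite !gP //; [lra | rewrite eq_sym].
move=> cK cK' maxK maxK' neq.
have diff (A B : {set G}) : #|A| = #|B| -> A != B -> exists2 x, x \in A & x \notin B.
  by move=> AB nAB; apply/subsetPn; apply: contraNN nAB => sAB; rewrite eqEcard sAB AB /=.
have [a aK aK'] := diff K K' (etrans maxK (esym maxK')) neq.
have [b bK' bK] : exists2 b, b \in K' & b \notin K.
  by apply: diff; [rewrite maxK maxK' | rewrite eq_sym].
have [gab|/ltW gba] := lerP (g a) (g b).
  by exists K, a, b; split=> //; apply: exch.
by exists K', b, a; split=> //; apply: exch.
Qed.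

Lemma chi1_threshold_not_unique : ~~ omega_unique G -> chi G < 3 * chi1 G.
Proof.
have [K cK maxK] := max_clique_exists G.
rewrite /omega_unique; set F := [set S | _] => nuniq.
have KF : K \in F by rewrite inE cK maxK eqxx.
have [K' K'F neq] : exists2 K', K' \in F & K != K'.
  have : 1 < #|F|.
    by rewrite ltn_neqAle eq_sym nuniq; apply/card_gt0P; exists K.
  rewrite (cardsD1 K) KF ltnS => /card_gt0P[K']; rewrite in_setD1 => /andP[nK K'F].
  by exists K'; rewrite // eq_sym.
move: K'F; rewrite inE => /andP[cK' /eqP maxK'].
have [M [a [b [aM bM cM maxM cM']]]] := threshold_max_exchange cK cK' maxK maxK' neq.
by rewrite (chi_split threshold_split) -maxM; apply: exchangeable_clique_lt_chi1 aM bM cM cM'.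
Qed.

(** A vertex of least weight serves: whatever outside [K] is adjacent to it is adjacent to all of
    [K]. *)
Lemma threshold_min (K : {set G}) : K != set0 ->
  exists2 a, a \in K &
    forall v y, v \notin K -> y \in K -> ~~ adj v y -> ~~ adj v a.
Proof.
case: thG => h [g gP]; case/set0Pn=> a0 a0K.
case: (arg_minP g a0K) => a aK amin; exists a => // v y vK yK.
have nv z : z \in K -> v != z by move=> zK; apply: contraNneq vK => ->.
have := amin y yK; rewrite !gP ?nv //; lra.
Qed.

(** By maximality of [K] its lightest vertex [a] has no neighbour outside, so [A] can be [a] with
    any other vertex of [K]. *)
Lemma chi1_threshold_mod2 : chi G %% 3 = 2 -> chi1 G <= (chi G + 2) %/ 3.
Proof.
have [K [cK iK maxK]] := split_max_clique threshold_split.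
rewrite (chi_split threshold_split) -maxK => K2.
have [a aK amin] : exists2 a, a \in K &
    forall v y, v \notin K -> y \in K -> ~~ adj v y -> ~~ adj v a.
  by apply: threshold_min; apply: contra_eqN K2 => /eqP->; rewrite cards0.
have : 0 < #|K :\ a| by have := cardsD1 a K; rewrite aK /=; lia.
case/card_gt0P=> b; rewrite !inE => /andP[ba bK].
have sA : [set a; b] \subset K by rewrite subUset !sub1set aK bK.
have A2 : #|[set a; b]| = 2 by rewrite cards2 eq_sym ba.
have := chi1_split_le (a := b) iK sA; rewrite A2 => /(_ isT) le1.
suff /le1 : forall v x, v \notin K -> x \in [set a; b] -> adj v x -> x = b.
  by have := subset_leq_card sA; rewrite A2; lia.
move=> v x vK; rewrite !inE => /orP[]/eqP-> // va.
have [y yK /(amin _ _ vK yK)] := max_clique_nonneighbor cK maxK vK.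
by rewrite va.
Qed.

(** By uniqueness a vertex outside [K] misses two vertices of [K], as a swap would otherwise give a
    second maximum clique. Hence the two lightest vertices [a] and [b] have no neighbour outside,
    and any third one completes [A]. *)
Lemma chi1_threshold_unique :
  omega_unique G -> chi G %% 3 = 0 -> chi1 G <= chi G %/ 3.
Proof.
have [K [cK iK maxK]] := split_max_clique threshold_split.
rewrite /omega_unique => uniqK K0.
(* Once [chi G = 0] is set aside, divisibility by 3 gives [K] at least three vertices. *)
have [chi0|chi_gt0] := posnP (chi G).
  by have := chi1_le_chi G; rewrite chi0.
have cardK : #|K| = chi G by rewrite maxK (chi_split threshold_split).
have onlyK (M : {set G}) : clique M -> #|M| = #|K| -> M = K.
  move: uniqK => /cards1P[N NE] cM cardM.
  have : M \in [set N] by rewrite -NE inE cM cardM maxK eqxx.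
  have : K \in [set N] by rewrite -NE inE cK maxK eqxx.
  by rewrite !inE => /eqP-> /eqP->.
have miss2 v a : v \notin K -> a \in K -> exists2 y, y \in K :\ a & ~~ adj v y.
  move=> vK aK; apply/exists_inP; rewrite -negb_forall_in.
  apply/negP=> /forall_inP adjv.
  have cM : clique (v |: K :\ a).
    by apply: exchange_clique => // x xK xa; apply: adjv; rewrite !inE xa.
  have MK : v |: K :\ a = K.
    apply: onlyK => //.
    by rewrite cardsU1 !inE (negPf vK) andbF (cardsD1 a K) aK.
  by move: vK; rewrite -MK !inE eqxx.
have [a aK amin] : exists2 a, a \in K &
    forall v y, v \notin K -> y \in K -> ~~ adj v y -> ~~ adj v a.
  by apply: threshold_min; rewrite -card_gt0 cardK.
have [b bKa bmin] : exists2 b, b \in K :\ a &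
    forall v y, v \notin K :\ a -> y \in K :\ a -> ~~ adj v y -> ~~ adj v b.
  apply: threshold_min; rewrite -card_gt0.
  by have := cardsD1 a K; rewrite aK cardK /=; lia.
have : 0 < #|K :\ a :\ b|.
  have := cardsD1 a K; have := cardsD1 b (K :\ a); rewrite aK bKa cardK /=; lia.
case/card_gt0P=> d; move: (bKa); rewrite !inE => /andP[ba bK] /and3P[db da dK].
pose A := [set a; b; d].
have sA : A \subset K by rewrite !subUset !sub1set aK bK dK.
have A3 : #|A| = 3.
  by rewrite /A setUC cardsU1 !inE (negPf da) (negPf db) cards2 eq_sym ba.
have := chi1_split_le (a := d) iK sA; rewrite A3 => /(_ isT) le1.
suff /le1 : forall v x, v \notin K -> x \in A -> adj v x -> x = d.
  by have := subset_leq_card sA; rewrite A3 cardK; lia.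
move=> v x vK; rewrite !inE -orbA => /or3P[]/eqP-> // vx.
  have [y yKa /(amin _ _ vK)] := miss2 v a vK aK.
  by rewrite vx => /(_ _)/negP[]; move: yKa; rewrite !inE => /andP[].
have [y yKa /(bmin _ _ _ yKa)] := miss2 v a vK aK.
by rewrite vx !inE (negPf vK) andbF => /(_ isT).
Qed.

(** The general split bound is already sharp for residue 1, and for residue 0 without uniqueness;
    the other two cases have their own constructions. *)
Lemma chi1_threshold : chi1 G =
  if (chi G == 0 %[mod 3]) && ~~ omega_unique G then chi G %/ 3 + 1
  else (chi G + 2) %/ 3.
Proof.
have up := chi1_split_upper threshold_split.
have low := chi_le_chi1 threshold_split.
have := chi1_threshold_not_unique; have := chi1_threshold_unique.
have := chi1_threshold_mod2; rewrite mod0n.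
case: (omega_unique G) => /= mod2 uniq nuniq; rewrite ?andbF ?andbT.
  have := uniq isT; lia.
by have := nuniq isT; case: eqP; lia.
Qed.

End Threshold.

(** * Extremal split graphs *)

Section Spider.
Variable t : nat.

(** The thick spider: [true] marks the clique, [false] the independent legs, and a leg misses only
    the clique vertex of its own index. *)
Definition spider_adj : rel ('I_t * bool) :=
  fun x y => (x.1 != y.1) && (x.2 || y.2).

Fact spider_adj_sym : symmetric spider_adj.
Proof. by move=> x y; rewrite /spider_adj eq_sym orbC. Qed.

Fact spider_adj_irrefl : irreflexive spider_adj.
Proof. by move=> x; rewrite /spider_adj eqxx. Qed.

Definition spider : sgraph := SGraph spider_adj_sym spider_adj_irrefl.

Definition body : {set spider} := [set x : spider | x.2].

Lemma clique_body : clique body.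
Proof.
apply/cliqueP=> -[a b] [a' b']; rewrite !inE /= /spider_adj /= => -> -> /eqP ne.
by rewrite andbT; apply: contra_notN ne => /eqP->.
Qed.

Lemma card_body : #|body| = t.
Proof.
have -> : body = [set (a, true) | a : 'I_t] :> {set 'I_t * bool}.
  apply/setP=> -[a b]; rewrite inE /=; apply/idP/imsetP => [->|[? _ [_ ->]] //].
  by exists a.
by rewrite card_imset ?card_ord // => a b [].
Qed.

Lemma split_spider : split_graph spider.
Proof.
apply/existsP; exists body; rewrite clique_body; apply/independentP=> x y.
by rewrite !inE /= /spider_adj => /negPf-> /negPf->; rewrite andbF.
Qed.

Lemma chi_spider : chi spider = t.
Proof.
apply/eqP; rewrite eqn_leq; apply/andP; split.
  by apply/chi_le; exists fst => x y /andP[].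
by rewrite -{1}card_body clique_le_chi // clique_body.
Qed.

(* Three vertices of the body sharing a colour with a leg form a diamond with it,
   and so do two such vertices with two legs adjacent to both: at most one colour
   class may fall short of three vertices of the body, and only by one. *)
Lemma chi1_spider_lower : 2 < t -> t + 2 <= 3 * chi1 spider.
Proof.
move=> t3; have /chi1_le[c [p cp]] := leqnn (chi1 spider).
have := clique_deficiency cp clique_body; rewrite card_body.
set n := fun i => #|fiber c body i|; rewrite -/(n _).
set D := \sum_i _ => tD; suff D2 : 1 < D by rewrite -tD leq_add2l.
have legF (a : 'I_t) : n (c (a, false)) <= 2.
  rewrite leqNgt /n; apply/negP; set F := fiber c body _ => gt2.
  (* Two vertices of [F] avoid the one that leg [a] misses; the third need not be adjacent to the
     leg. *)
  have : 1 < #|F :\ ((a, true) : spider)|.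
    by have := cardsD1 ((a, true) : spider) F; lia.
  case/card_gt1P=> u [w [uF wF uw]].
  have : 0 < #|F :\ u :\ w|.
    have := cardsD1 u F; have := cardsD1 w (F :\ u); lia.
  case/card_gt0P=> b; move: uF wF; rewrite !inE.
  case/and3P=> ua u2 /eqP cu /and3P[wa w2 /eqP cw] /and4P[bw bu b2 /eqP cb].
  have off (x : spider) : x.2 -> x != (a, true) -> @adj spider (a, false) x.
    case: x => x1 [] //= _ xa; rewrite /spider_adj /= andbT.
    by apply: contraNneq xa => ->.
  have /cliqueP cB := clique_body.
  apply: (@no_monochromatic_diamond _ _ c p cp (a, false) b u w);
    rewrite ?cu ?cw ?cb //; try exact: off; try (by apply: cB; rewrite ?inE).
  by apply: contraTneq b2 => <-.
have n_le i : 3 - n i <= D by rewrite /D (bigD1 i) //= leq_addr.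
have t0 : 0 < t by lia.
pose a0 := Ordinal t0; pose i := c (a0, false).
have ni : n i <= 2 := legF a0.
(* Legs of two colours make two classes fall short. *)
have [legs|] := boolP [forall a, c (a, false) == i]; last first.
  case/forallPn=> a nai; rewrite /D (bigD1 i) // (bigD1 (c (a, false))) //=.
  by have := legF a; rewrite -!/(n _); lia.
have [n1|n2] := leqP (n i) 1; first by have := n_le i; lia.
(* For [t = 3] the sum [t + D] is a multiple of 3, so a positive [D] is at least 3. *)
have [t3'|t4] := leqP t 3; first by have := n_le i; lia.
have /cards2P[u [w [uw FE]]] : n i == 2 by rewrite eqn_leq ni.
have : u \in fiber c body i by rewrite FE !inE eqxx.
have : w \in fiber c body i by rewrite FE !inE eqxx orbT.
rewrite !inE => /andP[w2 /eqP cw] /andP[u2 /eqP cu].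
(* As [t] is at least 4, two legs are adjacent to both [u] and [w]. *)
have : 1 < #|~: [set u.1; w.1]|.
  by have := cardsC [set u.1; w.1]; rewrite card_ord cards2; lia.
case/card_gt1P=> a [b [aF bF ab]].
move: aF bF; rewrite !inE !negb_or => /andP[au aw] /andP[bu bw].
have /cliqueP cB := clique_body.
have cleg d : c (d, false) = i by apply/eqP/(forallP legs).
case: (@no_monochromatic_diamond _ _ c p cp (a, false) (b, false) u w);
  rewrite /= /spider_adj ?cleg ?cu ?cw ?u2 ?w2 ?andbT //=.
  by apply: contraNneq ab => -[->].
by have /andP[] : adj u w by apply: cB; rewrite ?inE.
Qed.

Lemma chi1_spider : 2 < t -> chi1 spider = (t + 1) %/ 3 + 1.
Proof.
move=> t3; have := chi1_spider_lower t3; have := chi1_split_upper split_spider.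
rewrite chi_spider; lia.
Qed.

End Spider.

(** * Ceilings and assembly of the statement *)

Local Open Scope ring_scope.

(** Used with [m = 0] and [m = 1] for the two ceilings of the theorem. *)
Lemma ceil_third (n m : nat) (x : rat) :
  x = n%:Q - m%:Q -> (m <= n + 2)%N ->
  Num.ceil (x / 3) = ((n + 2 - m) %/ 3)%N%:Z.
Proof.
move=> -> le_mn; apply: ceil_def; set q := (_ %/ 3)%N.
have [lo hi] : (3 * q + m < n + 3)%N /\ (n <= 3 * q + m)%N.
  by rewrite /q; lia.
move: lo hi; rewrite -(ltr_nat rat) -(ler_nat rat) !(natrD, natrM) rmorphB /= -!pmulrn => lo hi.
by apply/andP; split; lra.
Qed.

Theorem theorem1p1 (R : realType) :
  (forall G : sgraph, threshold_graph G R ->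
     (chi1 G)%:Q = if (chi G == 0 %[mod 3])%N && ~~ omega_unique G
                   then (chi G)%:Q / 3 + 1
                   else (Num.ceil ((chi G)%:Q / 3))%:Q)
  /\ (forall G : sgraph, split_graph G ->
        (chi1 G)%:Z <= Num.ceil (((chi G)%:Q - 1) / 3) + 1)
  /\ (forall t : nat, (3 <= t)%N ->
        exists G : sgraph, [/\ split_graph G, chi G = t &
          (chi1 G)%:Z = Num.ceil ((t%:Q - 1) / 3) + 1])
  /\ (forall G : sgraph, split_graph G -> chi G = 2%N ->
        (chi1 G)%:Z < Num.ceil (((chi G)%:Q - 1) / 3) + 1)
  /\ (forall G : sgraph, split_graph G -> (chi G == 1 %[mod 3])%N ->
        (chi1 G)%:Q = ((chi G)%:Q + 2) / 3).
Proof.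
have ceil0 (n : nat) : Num.ceil (n%:Q / 3) = ((n + 2) %/ 3)%N%:Z.
  by rewrite (@ceil_third n 0) ?subn0 ?subr0.
have ceil1 (n : nat) : Num.ceil ((n%:Q - 1) / 3) = ((n + 1) %/ 3)%N%:Z.
  by rewrite (@ceil_third n 1) ?addn2 ?subn1 ?addn1.
split=> [G thG|].
  rewrite ceil0 (chi1_threshold thG); case: ifP => // /andP[/eqP chi0 _].
  have -> : (chi G)%:Q = 3 * (chi G %/ 3)%N%:Q.
    by rewrite -!pmulrn -natrM; congr _%:R; move: chi0; lia.
  by rewrite PoszD rmorphD /=; lra.
split=> [G splitG|].
  by rewrite ceil1 -PoszD lez_nat addn1 chi1_split_upper.
split=> [t t3|].
  exists (spider t); split; [exact: split_spider|exact: chi_spider|].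
  by rewrite ceil1 chi1_spider.
split=> [G splitG chi2|G splitG /eqP chiG].
  by rewrite ceil1 chi2; apply: chi1_split_bipartite.
(* For residue 1 the clique lower bound, rounded up, meets the split upper bound. *)
have -> : (chi G)%:Q = 3 * (chi1 G)%:Q - 2.
  apply/eqP; rewrite eq_sym subr_eq -!pmulrn -natrM -natrD eqr_nat.
  have := chi1_split_upper splitG; have := chi_le_chi1 splitG.
  by move: chiG; lia.
by lra.
Qed.
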